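(* Let $Q_0$ be the training distribution on $\mathcal{X}\times\mathcal{Y}$ and let $Q_t$ be a distribution on $\mathcal{X}\times\mathcal{Y}$ with label marginal vector $\mathbf{q}_t$, satisfying the label shift condition $Q_t(\mathbf{x}\mid y)=Q_0(\mathbf{x}\mid y)$ for all $\mathbf{x},y$. Let $f$ be any classifier and let $f_0$ be the classifier trained on data from $Q_0$. For $(\mathbf{x}_t,y_t)\sim Q_t$, let $i=f_0(\mathbf{x}_t)$ be the label predicted by $f_0$ and let $\mathbf{e}_i\in\mathbb{R}^M$ be the one-hot vector whose non-zero entry is $i$. If the confusion matrix $C_{f_0,Q_0}$ is invertible, then $$\hat{\mathbf{q}}_t=\left(C_{f_0,Q_0}^\top\right)^{-1}\mathbf{e}_i$$ is an unbiased estimator of $\mathbf{q}_t$, i.e. $\mathbb{E}_{Q_t}[\hat{\mathbf{q}}_t]=\mathbf{q}_t$. Further, if $\mathsf{diag}(C_{f,Q_0})$ is differentiable with respect to $f$, then \begin{align*} \ell(f;Q_t)&=\mathbb{E}_{Q_t}\left[\left\langle \mathbf{1}-\mathsf{diag}(C_{f,Q_0}),\hat{\mathbf{q}}_t\right\rangle\right],\\ \nabla_f\ell(f;Q_t)&=\mathbb{E}_{Q_t}\left[J_f^\top\hat{\mathbf{q}}_t\right], \end{align*} where $J_f=\frac{\partial}{\partial f}\left[\mathbf{1}-\mathsf{diag}(C_{f,Q_0})\right]$ is the Jacobian of $\mathbf{1}-\mathsf{diag}(C_{f,Q_0})$ with respect to $f$.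
   Context: $\mathcal{X}$ is a feature space and $\mathcal{Y}=\{1,\dots,M\}$ a finite label set. A classifier is a (measurable) map $f:\mathcal{X}\to\mathcal{Y}$. ''$f_0$ trained on data from $Q_0$'' just means that $f_0$ is a fixed classifier. For a distribution $Q$ on $\mathcal{X}\times\mathcal{Y}$, $Q(\mathbf{x}\mid y)$ is the class-conditional distribution and $Q(y)$ the label marginal. The label marginal vector of $Q_t$ is $\mathbf{q}_t\in\Delta^{M-1}$, $\mathbf{q}_t[i]=\mathbb{P}_{Q_t}(y_t=i)$, where $\Delta^{M-1}$ is the probability simplex in $\mathbb{R}^M$. The class-conditionals $Q_0(\cdot\mid y=i)$ are given for every $i\in\mathcal{Y}$, and $Q_t$ draws $y_t$ from $\mathbf{q}_t$ and then $\mathbf{x}_t$ from $Q_0(\cdot\mid y=y_t)$. The expected 0-1 loss is $\ell(f;Q)=\mathbb{P}_{(\mathbf{x},y)\sim Q}(f(\mathbf{x})\neq y)$. The confusion matrix of $f$ under $Q$ is the $M\times M$ matrix $C_{f,Q}[i,j]=\mathbb{P}_{\mathbf{x}\sim Q(\cdot\mid y=i)}(f(\mathbf{x})=j)$. $\mathsf{diag}(C)\in\mathbb{R}^M$ is the vector of diagonal entries of $C$ and $\mathbf{1}$ is the all-ones vector. Derivatives ''with respect to $f$'' are with respect to the real parameter vector of $f$: $f=f_\theta$ with $\theta$ in an open subset of $\mathbb{R}^d$; $\nabla_f$ is the (column) gradient and $\partial/\partial f$ the $M\times d$ Jacobian in $\theta$. *)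

(* Defs.v *)
From HB Require Import structures.
From mathcomp Require Import all_boot all_order all_algebra.
From mathcomp Require Import all_classical all_reals all_analysis.

Set Implicit Arguments.
Unset Strict Implicit.
Unset Printing Implicit Defensive.

Import Order.TTheory GRing.Theory Num.Theory.
Import numFieldNormedType.Exports.

Local Open Scope classical_set_scope.
Local Open Scope ring_scope.

(* The label set {1, ..., M} is 'I_m.+1, with M = m.+1 (it is nonempty since it
   carries a probability distribution), equipped with all its subsets. *)
HB.instance Definition _ (m : nat) := isPointed.Build 'I_m.+1 ord0.

HB.instance Definition _ (m : nat) := @isMeasurable.Build
  default_measure_display 'I_m.+1 discrete_measurable discrete_measurable0
  discrete_measurableC discrete_measurableU.

Section label_shift.
Context {d : measure_display} {X : measurableType d} {R : realType} {m : nat}.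

Local Notation label := 'I_m.+1.

(* A distribution on X * label together with its class-conditionals.  These are
   part of the data because the joint law does not determine [cond y] for a
   label [y] of probability 0, whereas the confusion matrix uses all of them. *)
Record labeled_dist := LabeledDist {
  joint : probability (X * label)%type R ;
  cond : label -> probability X R ;
  condP : forall (y : label) (A : set X), measurable A ->
    joint (A `*` [set y]) = (joint (setT `*` [set y]) * cond y A)%E }.

Definition label_marginal (Q : labeled_dist) : 'cV[R]_m.+1 :=
  \col_i fine (joint Q (setT `*` [set i])).

Definition is_label_shift (Q0 Qt : labeled_dist) : Prop :=
  forall (y : label) (A : set X), measurable A -> cond Qt y A = cond Q0 y A.

Definition loss (f : X -> label) (Q : labeled_dist) : R :=
  fine (joint Q [set z | f z.1 <> z.2]).

Definition confusion (f : X -> label) (Q : labeled_dist) : 'M[R]_m.+1 :=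
  \matrix_(i, j) fine (cond Q i (f @^-1` [set j])).

Definition qhat (f0 : X -> label) (Q0 : labeled_dist) (x : X) : 'cV[R]_m.+1 :=
  invmx (confusion f0 Q0)^T *m delta_mx (f0 x) 0.

End label_shift.

Arguments labeled_dist {d} X R m.

Definition diagv (R : Type) (n : nat) (C : 'M[R]_n) : 'cV[R]_n := \col_i C i i.

Definition inner (R : pzRingType) (n : nat) (u v : 'cV[R]_n) : R :=
  \sum_i u i 0 * v i 0.

(* Extended-real valued, so that an equation with [map_mx EFin v] entails that
   every coordinate has a finite expectation. *)
Definition vexpectation d (T : measurableType d) (R : realType)
    (P : probability T R) (n : nat) (V : T -> 'cV[R]_n) : 'cV[\bar R]_n :=
  \col_k ('E_P[fun z => V z k ord0])%E.

(* The library's ['J g t] acts on row vectors, [v *m 'J g t = 'd g t v], hence is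
   the transpose of the usual n x p matrix of partial derivatives. *)
Definition Jac (R : realType) (p n : nat) (F : 'rV[R]_p -> 'cV[R]_n)
    (t : 'rV[R]_p) : 'M[R]_(n, p) :=
  ('J (fun s => (F s)^T) t)^T.

Definition grad (R : realType) (p : nat) (g : 'rV[R]_p -> R)
    (t : 'rV[R]_p) : 'cV[R]_p :=
  \col_j 'D_(delta_mx 0 j) g t.

(* Main.v *)
(** Label shift makes the law of the label predicted by a classifier [g] under
    [Qt] equal to [(confusion g Q0)^T *m q], where [q] is the label marginal of
    [Qt]; inverting the transposed confusion matrix of [f0] therefore recovers
    [q] in expectation, and so does any linear image of it.  Conditioning on
    the true label, the loss is [<1 - diag C, q>], linear in [q], and so is its
    gradient; [q] can thus be replaced by its unbiased estimator in both. *)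

Require Import Defs.
From HB Require Import structures.
From mathcomp Require Import all_boot all_order all_algebra.
From mathcomp Require Import all_classical all_reals all_analysis.

Set Implicit Arguments.
Unset Strict Implicit.
Unset Printing Implicit Defensive.

Import Order.TTheory GRing.Theory Num.Theory.
Import numFieldNormedType.Exports.

Local Open Scope classical_set_scope.
Local Open Scope ring_scope.

Lemma trmx_continuous (K : numFieldType) (m n : nat) :
  continuous (@trmx K m n).
Proof.
move=> M s /= /nbhs_ballP[e e0 es].
apply/nbhs_ballP; exists e => //= N [e0' MN]; apply: es; split=> // i j.
by rewrite !mxE.
Qed.

(** The first-order expansion at [a] involves only values near [a], so ['d f a] also serves as
    differential of [g]. This is needed because the loss is known to equal an inner product only for
    parameters in [Theta]. *)
Lemma near_eq_differentiable (K : numFieldType) (V W : normedModType K)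
    (f g : V -> W) (a : V) :
  {near a, f =1 g} -> differentiable f a -> differentiable g a.
Proof.
move=> fg df; have dfc := diff_continuous df.
(* By [diff_unique], this expansion forces ['d g a = 'd f a], which is continuous. *)
suff dg : g \o shift a = cst (g a) + 'd f a +o_ 0 id.
  by apply/diff_locallyP; rewrite (diff_unique dfc dg).
have /eqaddoP fo := diff_locally df; apply/eqaddoP => e e0.
have fg0 : \forall x \near nbhs 0, f (x + a) = g (x + a).
  have := fg; rewrite -near_nbhs [X in X -> _](near_shift 0 a).
  by apply: filterS => x /=; rewrite subr0.
have := fo e e0; apply: filterS2 fg0 => x fgx.
by rewrite /= !fctE /= fgx (nbhs_singleton fg).
Qed.

Lemma measure_section_sum (d : measure_display) (X : measurableType d)
    (R : realType) (m : nat) (P : probability (X * 'I_m.+1)%type R)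
    (A : 'I_m.+1 -> set X) :
  (forall i, measurable (A i)) ->
  P [set z | A z.2 z.1] = (\sum_(i < m.+1) P (A i `*` [set i]))%E.
Proof.
move=> mA.
have -> : [set z | A z.2 z.1] = \bigcup_i (A i `*` [set i]).
  by apply/seteqP; split => [[x i] Ax|[x i] [j _ [/= Ax ->]]] //; exists i.
rewrite measure_fin_bigcup//=.
- rewrite (fsbigE (index_enum 'I_m.+1)) ?index_enum_uniq//; last first.
    by move=> i _; rewrite mem_index_enum.
  by apply: eq_bigl => i; rewrite in_setT.
- by move=> i j _ _ [[x k] [[_ <-] [_ <-]]].
- by move=> i _; exact: measurableX.
Qed.

(** [h \o Z] is a simple function: the combination of the indicators of the fibres of [Z] with
    coefficients [h j]. *)
Lemma expectation_comp_ord (d : measure_display) (T : measurableType d)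
    (R : realType) (P : probability T R) (n : nat) (Z : T -> 'I_n)
    (h : 'I_n -> R) :
  (forall j, measurable (Z @^-1` [set j])) ->
  ('E_P[fun z => h (Z z)] =
   (\sum_(j < n) h j * fine (P (Z @^-1` [set j])))%:E)%E.
Proof.
move=> mZ; rewrite unlock.
under eq_integral => z _.
  rewrite (_ : (h (Z z))%:E =
      \sum_(j < n) ((h j)%:E * (\1_(Z @^-1` [set j]) z)%:E))%E; last first.
    rewrite (bigD1 (Z z))//= big1 => [|j jZ]; rewrite indicE.
      by rewrite mem_set// mule1 adde0.
    by rewrite memNset ?mule0// => /= Zj; rewrite Zj eqxx in jZ.
  over.
rewrite integral_sum//; last first.
  by move=> j; apply: integrableZl => //; exact: integrable_indic.
rewrite -sumEFin; apply: eq_bigr => j _.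
rewrite integralZl//; last exact: integrable_indic.
by rewrite integral_indic// setIT EFinM fineK// fin_num_measure.
Qed.

Section label_shift.
Context (d : measure_display) (X : measurableType d) (R : realType) (m : nat).
Variables (Q0 Qt : labeled_dist X R m) (hshift : is_label_shift Q0 Qt).

(** Total probability over the true label; this is where label shift replaces [cond Qt] by
    [cond Q0]. Letting [A] depend on the label covers both the event of predicting [j] (constant
    [A]) and misclassification ([A i] the complement of the fibre over [i]). *)
Lemma joint_section (A : 'I_m.+1 -> set X) :
  (forall i, measurable (A i)) ->
  fine (joint Qt [set z | A z.2 z.1]) =
  \sum_(i < m.+1) label_marginal Qt i 0 * fine (cond Q0 i (A i)).
Proof.
move=> mA; rewrite measure_section_sum//.
have mT (i : 'I_m.+1) : measurable ([set: X] `*` [set i]).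
  exact: measurableX.
under eq_bigr => i _.
  rewrite condP// hshift// -[joint _ _]fineK ?fin_num_measure//.
  rewrite -[cond _ _ _]fineK ?fin_num_measure// -EFinM; over.
by rewrite sumEFin/=; apply: eq_bigr => i _; rewrite mxE.
Qed.

Lemma predicted_label_prob (g : X -> 'I_m.+1) (j : 'I_m.+1) :
  measurable_fun setT g ->
  fine (joint Qt ((fun z => g z.1) @^-1` [set j])) =
  ((confusion g Q0)^T *m label_marginal Qt) j 0.
Proof.
move=> mg.
rewrite (joint_section (A := fun=> g @^-1` [set j])) => [|i].
  by rewrite mxE; apply: eq_bigr => i _; rewrite mulrC !mxE.
by rewrite -[_ @^-1` _]setTI; exact: mg.
Qed.

Lemma loss_inner (g : X -> 'I_m.+1) :
  measurable_fun setT g ->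
  loss g Qt = inner (const_mx 1 - diagv (confusion g Q0)) (label_marginal Qt).
Proof.
move=> mg.
have mgi i : measurable (g @^-1` [set i]).
  by rewrite -[_ @^-1` _]setTI; exact: mg.
rewrite /loss (joint_section (A := fun i => ~` (g @^-1` [set i]))) => [|i].
  apply: eq_bigr => i _; rewrite mulrC !mxE probability_setC//.
  by rewrite fineB// fin_num_measure.
exact: measurableC.
Qed.

(** The matrix [B] lets one computation serve all three claims: the identity gives unbiasedness, a
    row vector the loss, and a transposed Jacobian the gradient. *)
Lemma vexpectation_mulmx_qhat (f0 : X -> 'I_m.+1) (n : nat)
    (B : 'M[R]_(n, m.+1)) :
  measurable_fun setT f0 -> confusion f0 Q0 \in unitmx ->
  vexpectation (joint Qt) (fun z => B *m qhat f0 Q0 z.1) =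
  map_mx EFin (B *m label_marginal Qt).
Proof.
move=> mf0 Cu; set C := (confusion f0 Q0)^T.
have Ctu : C \in unitmx by rewrite unitmx_tr.
apply/matrixP => k j; rewrite [LHS]mxE [RHS]mxE.
(* Multiplying by a one-hot vector selects a column, so the integrand depends on [z] only through
   the predicted label. *)
have -> : (fun z : X * 'I_m.+1 => (B *m qhat f0 Q0 z.1) k ord0) =
    fun z => (B *m invmx C) k (f0 z.1).
  by apply/funext => z; rewrite /qhat mulmxA -colE mxE.
rewrite (@expectation_comp_ord _ _ _ _ _ (fun z => f0 z.1)) => [|l].
  (* Write the marginal [q] as [invmx C *m (C *m q)]: the entries of [C *m q] are the probabilities
     of the predicted labels. *)
  congr _%:E; rewrite (ord1 j) -[in RHS](mulKmx Ctu (label_marginal Qt)).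
  rewrite (mulmxA B) [RHS]mxE; apply: eq_bigr => l _.
  by rewrite predicted_label_prob.
rewrite (_ : _ @^-1` _ = (f0 @^-1` [set l]) `*` setT); last first.
  by apply/seteqP; split => [[x i]//=|[x i] []].
by apply: measurableX => //; rewrite -[_ @^-1` _]setTI; exact: mf0.
Qed.

End label_shift.

(** Gives the shape, a sum of functions, on which [differentiable_sum] and [derive_sum] act. *)
Lemma inner_sum_fun (V : Type) (R : pzRingType) (n : nat) (F : V -> 'cV[R]_n)
    (q : 'cV[R]_n) :
  (fun s => inner (F s) q) = \sum_(i < n) (fun s => F s i 0 * q i 0).
Proof. by apply/funext => s; rewrite fct_sumE. Qed.

Section inner_differential.
Context (R : realType) (p n : nat).
Variables (F : 'rV[R]_p -> 'cV[R]_n) (q : 'cV[R]_n) (t : 'rV[R]_p).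
Hypothesis dF : differentiable F t.

Let dFi i : differentiable (fun s => F s i 0) t.
Proof. exact: (differentiable_comp dF (differentiable_coord _ _ _)). Qed.

Let dFq i : differentiable (fun s => F s i 0 * q i 0) t.
Proof. exact: (differentiableZl (q i 0 : R^o) (dFi i)). Qed.

Lemma differentiable_inner : differentiable (fun s => inner (F s) q) t.
Proof. by rewrite inner_sum_fun; exact: differentiable_sum. Qed.

(** Applying ['J] to a basis row vector extracts one of its rows, and a matrix-valued map is derived
    entrywise. *)
Lemma Jac_derive i j : Jac F t i j = 'D_(delta_mx 0 j) (fun s => F s i 0) t.
Proof.
have dFT : differentiable (fun s => (F s)^T) t.
  apply: (differentiable_comp dF); apply: linear_differentiable.
  exact: trmx_continuous.
rewrite mxE; have := deriveEjacobian (delta_mx 0 j) dFT.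
rewrite -rowE derive_mx; last exact: diff_derivable.
move=> /matrixP/(_ 0 i); rewrite !mxE => <-.
by congr ('D_ _ _ _); apply/funext => s; rewrite mxE.
Qed.

Lemma grad_inner : grad (fun s => inner (F s) q) t = (Jac F t)^T *m q.
Proof.
apply/matrixP => j k; rewrite (ord1 k) !mxE inner_sum_fun.
rewrite derive_sum; last by move=> i; exact: diff_derivable.
apply: eq_bigr => i _; rewrite mxE Jac_derive.
rewrite (_ : (fun s => _) = q i 0 \*o (fun s => F s i 0)); last first.
  by apply/funext => s; rewrite /= mulrC.
have dv : derivable (fun s => F s i 0) t (delta_mx 0 j).
  exact: diff_derivable.
rewrite (deriveMl _ dv).
exact: mulrC.
Qed.

End inner_differential.

Theorem theorem1 (d : measure_display) (X : measurableType d) (R : realType)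
    (m : nat) (Q0 Qt : labeled_dist X R m) (hshift : is_label_shift Q0 Qt)
    (f0 : X -> 'I_m.+1) (hf0 : measurable_fun setT f0)
    (hC : confusion f0 Q0 \in unitmx)
    (p : nat) (Theta : set 'rV[R]_p) (hTheta : open Theta)
    (f : 'rV[R]_p -> X -> 'I_m.+1)
    (hf : forall theta, Theta theta -> measurable_fun setT (f theta)) :
  vexpectation (joint Qt) (fun z => qhat f0 Q0 z.1)
    = map_mx EFin (label_marginal Qt)
  /\
  forall theta : 'rV[R]_p, Theta theta ->
    differentiable (fun t => diagv (confusion (f t) Q0)) theta ->
    [/\ (loss (f theta) Qt)%:E
          = ('E_(joint Qt)[fun z =>
               (inner (const_mx 1 - diagv (confusion (f theta) Q0))
                      (qhat f0 Q0 z.1))%R])%E,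
        differentiable (fun t => loss (f t) Qt) theta
      & map_mx EFin (grad (fun t => loss (f t) Qt) theta)
          = vexpectation (joint Qt) (fun z =>
              (Jac (fun t => const_mx 1 - diagv (confusion (f t) Q0)) theta)^T
                *m qhat f0 Q0 z.1)].

Proof.
split.
  rewrite -[RHS](f_equal (map_mx EFin) (mul1mx _)).
  rewrite -(vexpectation_mulmx_qhat hshift 1%:M hf0 hC).
  by under [in RHS]eq_fun => z do rewrite mul1mx.
move=> theta Ttheta dC.
set F := fun t => const_mx 1 - diagv (confusion (f t) Q0).
have dF : differentiable F theta by exact: differentiableB.
(* [loss_inner] requires [f t] to be measurable, which holds throughout the open set [Theta], a
   neighbourhood of [theta]. *)
have lossE : {near theta,
    (fun t => inner (F t) (label_marginal Qt)) =1 (fun t => loss (f t) Qt)}.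
  near=> t; rewrite (loss_inner hshift)//; apply: hf.
  by near: t; exact: open_nbhs_nbhs.
split.
- rewrite (loss_inner hshift); last exact: hf.
  (* The inner product is read as the sole entry of a 1 x 1 matrix product. *)
  have /matrixP/(_ 0 0) := vexpectation_mulmx_qhat hshift (F theta)^T hf0 hC.
  have innerE (v : 'cV[R]_m.+1) : ((F theta)^T *m v) 0 0 = inner (F theta) v.
    by rewrite mxE; apply: eq_bigr => i _; rewrite mxE.
  rewrite !mxE -innerE mxE => <-.
  by congr expectation; apply/funext => z; rewrite innerE.
- exact: near_eq_differentiable lossE (differentiable_inner _ dF).
- rewrite vexpectation_mulmx_qhat// -grad_inner//; congr map_mx.
  apply/matrixP => j k; rewrite !mxE; apply: near_eq_derive.
  by apply: filterS lossE => t ->.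
Unshelve. all: by end_near. Qed.
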